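(* Let $M$ be an arbitrary first-order structure in a language $L$, let $G:=\operatorname{Aut}(M)$ with the pointwise convergence topology, and let $\bar m$ be an enumeration of $M$. Let $\mathcal{M}$, $\mathcal{M}^*=(G^*,M^*,\dots)$, $\operatorname{tp}^{\mathrm{full}}$ and $\Sigma^{\mathcal{M}}=\{\operatorname{tp}^{\mathrm{full}}(\sigma(\bar m)):\sigma\in G^*\}$ be as in the context. Then the formula $$\operatorname{tp}^{\mathrm{full}}(\sigma(\bar m))\cdot g:=\operatorname{tp}^{\mathrm{full}}(\sigma(g(\bar m)))\qquad(\sigma\in G^*,\ g\in G)$$ yields a well-defined right action of $G$ on $\Sigma^{\mathcal{M}}$, and with this action $(G,\Sigma^{\mathcal{M}},\operatorname{tp}^{\mathrm{full}}(\bar m))$ is the universal right $G$-ambit. In particular, the universal right $G$-ambit is zero-dimensional.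
   Context: The topology on $G=\operatorname{Aut}(M)$ is pointwise convergence: basic open neighborhoods of the identity are pointwise stabilizers of finite subsets of $M$. $\mathcal{M}$ is the two-sorted structure with disjoint sorts $G$ and $M$, equipped with a predicate for every subset of every finite Cartesian product of the sorts (the ''full language''); in particular the action of $G$ on $M$ is $\emptyset$-definable and every element of $\mathcal{M}$ is $\emptyset$-definable. $\mathcal{M}^*=(G^*,M^*,\dots)\succ\mathcal{M}$ is a monster model (a $\kappa$-saturated, strongly $\kappa$-homogeneous elementary extension for a sufficiently large $\kappa$); $G^*$ acts on $M^*$ via the interpretation of the action, and for $\sigma\in G^*$, $\sigma(\bar m)$ is the coordinatewise image of $\bar m$. $\operatorname{tp}^{\mathrm{full}}$ denotes the complete type over $\emptyset$ in the full language, in variables $\bar x$ indexed like $\bar m$. $\Sigma^{\mathcal{M}}$ carries the subspace topology from the Stone space of such types (basic clopen sets $[\varphi(\bar x)]=\{p:\varphi(\bar x)\in p\}$). A right $G$-ambit is a compact Hausdorff space with a continuous right $G$-action and a distinguished point whose orbit is dense; it is universal if it maps onto every right $G$-ambit by a continuous $G$-equivariant map preserving distinguished points. *)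

(* Defs.v *)
From HB Require Import structures.
From mathcomp Require Import all_boot.
From mathcomp Require Import all_classical topology.

Set Implicit Arguments.
Unset Strict Implicit.
Unset Printing Implicit Defensive.

Local Open Scope classical_set_scope.
Local Open Scope card_scope.

HB.structure Definition PreTopologicalGroup := {G of Group G & Topological G}.

HB.mixin Record PreTopologicalGroup_isTopologicalGroup G
    of PreTopologicalGroup G := {
  mulg_continuous : continuous (fun z : G * G => (z.1 * z.2)%g);
  invg_continuous : continuous (fun g : G => (g^-1)%g)
}.

#[short(type="topologicalGroupType")]
HB.structure Definition TopologicalGroup :=
  {G of PreTopologicalGroup_isTopologicalGroup G & PreTopologicalGroup G}.

Section Ambits.
Variable G : topologicalGroupType.

Definition right_action (X : Type) (act : X -> G -> X) : Prop :=
  (forall x, act x 1%g = x) /\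
  (forall x g h, act x (g * h)%g = act (act x g) h).

Definition right_ambit (X : topologicalType) (act : X -> G -> X) (x0 : X)
    : Prop :=
  [/\ compact [set: X], hausdorff_space X, right_action act,
      continuous (fun z : X * G => act z.1 z.2)
    & dense (range (act x0))].

Definition universal_right_ambit (X : topologicalType) (act : X -> G -> X)
    (x0 : X) : Prop :=
  right_ambit act x0 /\
  forall (Y : topologicalType) (actY : Y -> G -> Y) (y0 : Y),
    right_ambit actY y0 ->
    exists f : X -> Y,
      [/\ continuous f, forall x g, f (act x g) = actY (f x) g, f x0 = y0
        & range f = [set: Y]].

End Ambits.

(* The library's [zero_dimensional] only asks that clopen sets separate points;
   this is the usual notion: the clopen sets form a base of the topology. *)
Definition clopen_base (X : topologicalType) : Prop :=
  basis [set U : set X | clopen U].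

Record language := Language {
  fsym : Type;
  farity : fsym -> nat;
  rsym : Type;
  rarity : rsym -> nat
}.

Record structure (L : language) := Structure {
  carrier :> Type;
  fint : forall f : fsym L, ('I_(farity f) -> carrier) -> carrier;
  rint : forall r : rsym L, set ('I_(rarity r) -> carrier)
}.

Section Automorphisms.
Variables (L : language) (M : structure L).

Record aut := Aut {
  aut_fun :> M -> M;
  aut_bij : bijective aut_fun;
  aut_fint : forall (f : fsym L) x,
    aut_fun (fint (f := f) x) = fint (f := f) (aut_fun \o x);
  aut_rint : forall (r : rsym L) x,
    rint (r := r) (aut_fun \o x) <-> rint (r := r) x
}.

Lemma aut_eq (g h : aut) : (forall a, g a = h a) -> g = h.
Proof.
case: g => g bg fg rg; case: h => h bh fh rh /= /funext gh.
by move: bg fg rg; rewrite gh => *; congr Aut; exact: Prop_irrelevance.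
Qed.

HB.instance Definition _ := gen_eqMixin aut.
HB.instance Definition _ := gen_choiceMixin aut.

Lemma id_aut_rint (r : rsym L) (x : 'I_(rarity r) -> M) :
  rint (r := r) (idfun \o x) <-> rint (r := r) x.
Proof. by []. Qed.

Definition aut1 : aut :=
  @Aut idfun (Bijective (frefl _) (frefl _)) (fun _ _ => erefl) id_aut_rint.

Lemma comp_aut_fint (g h : aut) (f : fsym L) x :
  (g \o h) (fint (f := f) x) = fint (f := f) ((g \o h) \o x).
Proof. by rewrite /= !aut_fint. Qed.

Lemma comp_aut_rint (g h : aut) (r : rsym L) x :
  rint (r := r) ((g \o h) \o x) <-> rint (r := r) x.
Proof. exact: iff_trans (aut_rint g (h \o x)) (aut_rint h x). Qed.

Definition autM (g h : aut) : aut :=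
  Aut (bij_comp (aut_bij g) (aut_bij h))
      (@comp_aut_fint g h) (@comp_aut_rint g h).

Lemma aut_surj (g : aut) b : exists a, g a = b.
Proof. by case: (aut_bij g) => h _ hK; exists (h b). Qed.

Definition aut_inv_fun (g : aut) (b : M) : M := sval (cid (aut_surj g b)).

Lemma aut_invK (g : aut) : cancel (aut_inv_fun g) g.
Proof. by move=> b; rewrite /aut_inv_fun; case: cid. Qed.

Lemma aut_Kinv (g : aut) : cancel g (aut_inv_fun g).
Proof. by move=> a; apply: (bij_inj (aut_bij g)); rewrite aut_invK. Qed.

Lemma aut_inv_comp (g : aut) n (x : 'I_n -> M) : g \o (aut_inv_fun g \o x) = x.
Proof. by apply/funext => i /=; rewrite aut_invK. Qed.

Lemma inv_aut_fint (g : aut) (f : fsym L) x :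
  aut_inv_fun g (fint (f := f) x) = fint (f := f) (aut_inv_fun g \o x).
Proof. by rewrite -[x in LHS](aut_inv_comp g) -aut_fint aut_Kinv. Qed.

Lemma inv_aut_rint (g : aut) (r : rsym L) x :
  rint (r := r) (aut_inv_fun g \o x) <-> rint (r := r) x.
Proof. by apply: iff_trans (iff_sym (aut_rint g _)) _; rewrite aut_inv_comp. Qed.

Definition autV (g : aut) : aut :=
  Aut (Bijective (aut_invK g) (aut_Kinv g))
      (@inv_aut_fint g) (@inv_aut_rint g).

Lemma autMA : associative autM. Proof. by move=> ? ? ?; exact: aut_eq. Qed.
Lemma aut1M : left_id aut1 autM. Proof. by move=> ?; exact: aut_eq. Qed.
Lemma autM1 : right_id aut1 autM. Proof. by move=> ?; exact: aut_eq. Qed.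
Lemma autVM : left_inverse aut1 autV autM.
Proof. by move=> g; apply: aut_eq => a; exact: (aut_Kinv g a). Qed.
Lemma autMV : right_inverse aut1 autV autM.
Proof. by move=> g; apply: aut_eq => a; exact: (aut_invK g a). Qed.

HB.instance Definition _ := isGroup.Build aut autMA aut1M autM1 autVM autMV.

(* Pointwise convergence: for F finite, [agree_on g F] is the coset g Stab(F). *)
Definition agree_on (g : aut) (F : set M) : set aut :=
  [set h | forall a, F a -> h a = g a].

Definition aut_nbhs (g : aut) : set_system aut :=
  filter_from [set F : set M | finite_set F] (agree_on g).

HB.instance Definition _ := hasNbhs.Build aut aut_nbhs.

Lemma aut_nbhs_filter (g : aut) : ProperFilter (nbhs g).
Proof.
apply: filter_from_proper; last by move=> F _; exists g.
apply: filter_from_filter; first by exists set0; exact: finite_set0.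
move=> F1 F2 f1 f2; exists (F1 `|` F2); first by rewrite /= finite_setU.
by move=> h hF; split=> a aF; apply: hF; [left|right].
Qed.

Lemma aut_nbhs_singleton (g : aut) (A : set aut) : nbhs g A -> A g.
Proof. by case=> F _; apply. Qed.

Lemma aut_nbhs_nbhs (g : aut) (A : set aut) : nbhs g A -> nbhs g (nbhs^~ A).
Proof.
case=> F fF FA; exists F => // h hg; exists F => // k kh.
by apply: FA => a aF; rewrite kh// hg.
Qed.

HB.instance Definition _ := Nbhs_isNbhsTopological.Build aut
  aut_nbhs_filter aut_nbhs_singleton aut_nbhs_nbhs.

Lemma aut_mulg_continuous : continuous (fun z : aut * aut => (z.1 * z.2)%g).
Proof.
move=> [g h] A [F fF FA]; exists (agree_on g (h @` F), agree_on h F) => /=.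
  by split; [exists (h @` F) => //; exact: finite_image | exists F].
move=> [g' h'] /= [gg' hh']; apply: FA => a aF.
change (g' (h' a) = g (h a)).
by rewrite hh'// gg'//; exists a.
Qed.

Lemma aut_invg_continuous : continuous (fun g : aut => (g^-1)%g).
Proof.
move=> g A [F fF FA]; exists (aut_inv_fun g @` F); first exact: finite_image.
move=> h gh; apply: FA => a aF; apply: (bij_inj (aut_bij h)).
change (h (aut_inv_fun h a) = h (aut_inv_fun g a)).
by rewrite (aut_invK h) gh ?(aut_invK g)//; exists a.
Qed.

HB.instance Definition _ := PreTopologicalGroup_isTopologicalGroup.Build aut
  aut_mulg_continuous aut_invg_continuous.

End Automorphisms.

Fixpoint hprod (S : Type) (A : S -> Type) (l : seq S) : Type :=
  if l is s :: l' then (A s * hprod A l')%type else unit.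

Fixpoint hmap (S : Type) (A B : S -> Type) (f : forall s, A s -> B s)
    (l : seq S) : hprod A l -> hprod B l :=
  match l with
  | [::] => fun _ => tt
  | s :: l' => fun x => (f s x.1, hmap f x.2)
  end.

(* Adjoins to the family of variables V one new variable of sort s. *)
Inductive extend (S : Type) (V : S -> Type) (s : S) : S -> Type :=
| Old t of V t : extend V s t
| New : extend V s s.
Arguments Old {S V s t}.
Arguments New {S V s}.

Definition extend_env (S : Type) (V A : S -> Type) (s : S)
    (v : forall t, V t -> A t) (a : A s) (t : S) (x : extend V s t) : A t :=
  match x in extend _ _ t' return A t' with
  | Old t' y => v t' y
  | New => a
  end.

Record signature (S : Type) := Signature {
  sym : Type;
  arity : sym -> seq S
}.

Record model (S : Type) (Sg : signature S) := Model {
  sort_of :> S -> Type;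
  interp : forall R : sym Sg, set (hprod sort_of (arity R))
}.

Section FirstOrder.
Variables (S : Type) (Sg : signature S).

(* Formulas whose free variables of sort s are among the elements of V s. *)
Inductive form (V : S -> Type) : Type :=
| Rel (R : sym Sg) of hprod V (arity R)
| Equ s of V s & V s
| Bot
| Not of form V
| And of form V & form V
| Ex s of form (extend V s).

HB.instance Definition _ V := gen_eqMixin (form V).
HB.instance Definition _ V := gen_choiceMixin (form V).

Fixpoint sat (N : model Sg) (V : S -> Type) (phi : form V) {struct phi} :
    (forall s, V s -> N s) -> Prop :=
  match phi with
  | Rel R x => fun v => interp (hmap v x)
  | Equ s x y => fun v => v s x = v s y
  | Bot => fun _ => False
  | Not p => fun v => ~ sat p v
  | And p q => fun v => sat p v /\ sat q v
  | Ex s p => fun v => exists a : N s, sat p (extend_env v a)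
  end.

Record elementary_extension (A : model Sg) := ElementaryExtension {
  ee_model :> model Sg;
  ee_emb : forall s, A s -> ee_model s;
  ee_elementary : forall (V : S -> Type) (phi : form V)
      (v : forall s, V s -> A s),
    sat phi v <-> sat phi (fun s x => ee_emb (v s x))
}.

(* The cardinal kappa is represented by a type K of that cardinality. *)
Definition card_below (K T : Type) (B : set T) : Prop :=
  B #<= [set: K] /\ ~ ([set: K] #<= B).

Definition params (N : model Sg) (B : set {s : S & N s}) (s : S) : Type :=
  {x : N s | B (existT _ s x)}.

Definition params_val (N : model Sg) (B : set {s : S & N s}) (s : S)
  (x : params B s) : N s := sval x.

Definition saturated (K : Type) (N : model Sg) : Prop :=
  forall B : set {s : S & N s}, card_below K B ->
  forall (s : S) (p : set (form (extend (params B) s))),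
    (forall q, finite_set q -> q `<=` p ->
      exists a : N s, forall phi, q phi ->
        sat phi (extend_env (params_val (B := B)) a)) ->
    exists a : N s, forall phi, p phi ->
      sat phi (extend_env (params_val (B := B)) a).

Definition model_automorphism (N : model Sg) (h : forall s, N s -> N s)
    : Prop :=
  (forall s, bijective (h s)) /\
  (forall (R : sym Sg) (x : hprod N (arity R)),
    interp (hmap h x) <-> interp x).

Definition strongly_homogeneous (K : Type) (N : model Sg) : Prop :=
  forall B : set {s : S & N s}, card_below K B ->
  forall f : forall s, params B s -> N s,
    (forall phi : form (params B),
      sat phi (params_val (B := B)) <-> sat phi f) ->
    exists2 h : forall s, N s -> N s,
      model_automorphism h & forall s x, h s (params_val x) = f s x.

(* "kappa is sufficiently large" is read as: kappa exceeds both the number of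
   symbols of the language and the size of the small model A. *)
Definition monster (K : Type) (A : model Sg) (N : elementary_extension A)
    : Prop :=
  [/\ card_below K [set: sym Sg], card_below K [set: {s : S & A s}],
      saturated K N & strongly_homogeneous K N].

Section CompleteTypes.
Variables (N : model Sg) (V : S -> Type).

(* Complete types over the empty set, in the variables V; consistency with the
   theory of N is finite satisfiability in N. *)
Record complete_type := CompleteType {
  ct_set :> form V -> Prop;
  ct_finsat : forall q, finite_set q -> q `<=` ct_set ->
    exists v : forall s, V s -> N s, forall phi, q phi -> sat phi v;
  ct_complete : forall phi, ct_set phi \/ ct_set (Not phi)
}.

HB.instance Definition _ := gen_eqMixin complete_type.
HB.instance Definition _ := gen_choiceMixin complete_type.

Lemma tp_finsat (v : forall s, V s -> N s) (q : set (form V)) :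
  finite_set q -> q `<=` [set phi | sat phi v] ->
  exists w : forall s, V s -> N s, forall phi, q phi -> sat phi w.
Proof. by move=> _ qv; exists v. Qed.

Definition tp (v : forall s, V s -> N s) : complete_type :=
  @CompleteType [set phi | sat phi v] (@tp_finsat v) (fun phi => EM (sat phi v)).

(* A complete type is closed under consequences of finitely many formulas. *)
Lemma ct_entail (p : complete_type) (q : set (form V)) (phi : form V) :
  finite_set q -> q `<=` p ->
  (forall v : forall s, V s -> N s, (forall x, q x -> sat x v) -> sat phi v) ->
  p phi.
Proof.
move=> fq qp qphi; have [//|pn] := ct_complete p phi; exfalso.
have [| |v vq] := @ct_finsat p (q `|` [set Not phi]).
- by rewrite finite_setU; split=> //; exact: finite_set1.
- by move=> x [/qp//|->].
- apply: (vq (Not phi)); first by right.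
  by apply: qphi => x qx; apply: vq; left.
Qed.

Lemma ct_and (p : complete_type) (phi psi : form V) :
  p (And phi psi) <-> p phi /\ p psi.
Proof.
split=> [pa|[p1 p2]].
  by split; apply: (@ct_entail p [set And phi psi]) => [|x ->//|v /(_ _ erefl) []//];
    exact: finite_set1.
apply: (@ct_entail p ([set phi] `|` [set psi])) => [|x [->|->]//|v h].
  by rewrite finite_setU; split; exact: finite_set1.
by split; apply: h; [left|right].
Qed.

Lemma ct_top (p : complete_type) : p (Not (Bot V)).
Proof.
by apply: (@ct_entail p set0) => [|x []|v _ []]; exact: finite_set0.
Qed.

(* The Stone topology: the sets {q | q contains phi} are a base. *)
Definition ct_nbhs (p : complete_type) : set_system complete_type :=
  filter_from [set phi | p phi] (fun phi => [set q : complete_type | q phi]).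

HB.instance Definition _ := hasNbhs.Build complete_type ct_nbhs.

Lemma ct_nbhs_filter (p : complete_type) : ProperFilter (nbhs p).
Proof.
apply: filter_from_proper; last by move=> phi pphi; exists p.
apply: filter_from_filter; first by exists (Not (Bot V)); exact: ct_top.
move=> phi psi p1 p2; exists (And phi psi); first exact/ct_and.
by move=> q /ct_and.
Qed.

Lemma ct_nbhs_singleton (p : complete_type) (A : set complete_type) :
  nbhs p A -> A p.
Proof. by case=> phi pphi; apply. Qed.

Lemma ct_nbhs_nbhs (p : complete_type) (A : set complete_type) :
  nbhs p A -> nbhs p (nbhs^~ A).
Proof. by case=> phi pphi phiA; exists phi => // q qphi; exists phi. Qed.

HB.instance Definition _ := Nbhs_isNbhsTopological.Build complete_type
  ct_nbhs_filter ct_nbhs_singleton ct_nbhs_nbhs.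

End CompleteTypes.

End FirstOrder.
Arguments Rel {S Sg V} R.
Arguments Equ {S Sg V s}.
Arguments Bot {S Sg V}.
Arguments Ex {S Sg V} s.

Inductive full_sort := sortG | sortM.

Section FullStructure.
Variables (L : language) (M : structure L).

Definition full_carrier (s : full_sort) : Type :=
  match s with sortG => aut M | sortM => M end.

Definition full_sig : signature full_sort :=
  @Signature full_sort {l : seq full_sort & set (hprod full_carrier l)}
    (@projT1 _ _).

Definition full_model : model full_sig :=
  @Model full_sort full_sig full_carrier (fun R => projT2 R).

Definition action_sym : sym full_sig :=
  existT (fun l => set (hprod full_carrier l)) [:: sortG; sortM; sortM]
    (fun z => (z.1 : aut M) z.2.1 = z.2.2.1).

Variable N : elementary_extension full_model.

Definition action_graph (sigma : N sortG) (a b : N sortM) : Prop :=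
  interp (R := action_sym) (sigma, (a, (b, tt))).

Let novar (s : full_sort) : Type := void.

Lemma action_graph_total sigma a : exists b, action_graph sigma a b.
Proof.
pose phi : form full_sig novar :=
  Not (Ex sortG (Ex sortM (Not (Ex sortM
    (Rel action_sym (Old (Old New), (Old New, (New, tt)))))))).
have [+ _] := ee_elementary N phi (fun s (x : novar s) => of_void _ x).
move=> H; apply: contrapT => Nb; apply: H; last by exists sigma, a.
by case=> g [c]; apply; exists ((g : aut M) c).
Qed.

Lemma action_graph_functional sigma a b c :
  action_graph sigma a b -> action_graph sigma a c -> b = c.
Proof.
pose phi : form full_sig novar :=
  Not (Ex sortG (Ex sortM (Ex sortM (Ex sortM
    (And (And
      (Rel action_sym
        (Old (Old (Old New)), (Old (Old New), (Old New, tt))))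
      (Rel action_sym
        (Old (Old (Old New)), (Old (Old New), (New, tt)))))
      (Not (Equ (Old New) New))))))).
have [+ _] := ee_elementary N phi (fun s (x : novar s) => of_void _ x).
move=> H ab ac; apply: contrapT => bc; apply: H; last by exists sigma, a, b, c.
by case=> g [x [y [z [[/= <- <-]]]]].
Qed.

Definition star_act (sigma : N sortG) (a : N sortM) : N sortM :=
  sval (cid (action_graph_total sigma a)).

Definition tuple_vars (I : Type) (s : full_sort) : Type :=
  match s with sortG => void | sortM => I end.

Definition tuple_env (I : Type) (a : I -> N sortM) (s : full_sort) :
    tuple_vars I s -> N s :=
  match s with sortG => fun x => of_void _ x | sortM => a end.

Definition tp_full (I : Type) (a : I -> N sortM) :
    complete_type N (tuple_vars I) :=
  tp (tuple_env a).

(* M as a subset of M^*. *)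
Definition star_incl (a : M) : N sortM := @ee_emb _ _ _ N sortM a.

Definition Sigma (I : Type) (m : I -> M) :
    set (complete_type N (tuple_vars I)) :=
  [set p | exists sigma : N sortG,
     p = tp_full (fun i => star_act sigma (star_incl (m i)))].

End FullStructure.
Arguments star_incl {L M} N a.
Arguments Sigma {L M} N {I} m.

(* Main.v *)
Require Import Defs.
From mathcomp Require Import all_boot.
From mathcomp Require Import all_classical topology.

Set Implicit Arguments.
Unset Strict Implicit.
Unset Printing Implicit Defensive.

Local Open Scope classical_set_scope.

(* By substitution, a formula in x = sigma(m) is a formula in sigma over M; hence
   saturation makes Sigma compact, elementarity makes the orbit of tp(m) dense,
   and tp(sigma(g(m))) is a reindexing of tp(sigma(m)) because m enumerates M.
   A formula mentions finitely many variables, so it only sees g up to some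
   Stab(F) with F finite: this gives joint continuity. Conversely every union of
   cosets g Stab(F) is the trace on the orbit of a clopen set of Sigma. Given an
   ambit (Y, y0), each neighbourhood W of y contains B * V with B a neighbourhood
   of y and V one of 1, and a clopen set separates {g | y0 g in B} from the
   complement of {g | y0 g in B} V; this forces y0 g to converge along every
   point of Sigma, and the limit is the required map Sigma -> Y. *)

(** * Ambits of a topological group: limits along orbits and universality *)

Section AmbitTheory.
Variable G : topologicalGroupType.

Lemma hausdorff_dense_eq (X Y : topologicalType) (f h : X -> Y) (D : set X) :
  hausdorff_space Y -> continuous f -> continuous h -> dense D ->
  (forall x, D x -> f x = h x) -> f = h.
Proof.
move=> hY cf ch dD fh; apply/funext => x; apply: hY => A B fA hB.
have : nbhs x (f @^-1` A `&` h @^-1` B).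
  by apply: filterI; [exact: cf | exact: ch].
rewrite nbhsE => -[O [oO Ox] OAB].
have [|z [/OAB[Az Bz] Dz]] := dD O _ oO; first by exists x.
by exists (f z); split => //; rewrite fh.
Qed.

Lemma right_ambit_map_unique (X Y : topologicalType) (actX : X -> G -> X)
    (x0 : X) (actY : Y -> G -> Y) (y0 : Y) (f h : X -> Y) :
  right_ambit actX x0 -> hausdorff_space Y ->
  continuous f -> continuous h ->
  (forall x g, f (actX x g) = actY (f x) g) ->
  (forall x g, h (actX x g) = actY (h x) g) ->
  f x0 = y0 -> h x0 = y0 -> f = h.
Proof.
move=> [_ _ _ _ dX] hY cf ch ef eh f0 h0.
apply: (hausdorff_dense_eq hY cf ch dX) => _ [g _ <-].
by rewrite ef eh f0 h0.
Qed.

Lemma right_ambit_act_continuous (X : topologicalType) (actX : X -> G -> X)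
    (x0 : X) (g : G) :
  right_ambit actX x0 -> continuous (actX^~ g).
Proof.
move=> [_ _ _ cX _] z.
apply: (@continuous_comp _ _ _ (fun z => (z, g)) (fun z => actX z.1 z.2)).
  by apply: cvg_pair => //; exact: cvg_cst.
exact: cX.
Qed.

(** Compactness of [Y] yields only a cluster point [y] of the points [y0 g] as [x0 g] approaches
    [x]. Separation makes it a limit: if the clopen set attached to a small neighbourhood [B] of [y]
    missed [x], its complement would be a neighbourhood of [x] along which [y0 g] avoids [B]. *)
Lemma ambit_limit (X Y : topologicalType) (actX : X -> G -> X) (x0 : X)
    (actY : Y -> G -> Y) (y0 : Y) :
  right_ambit actX x0 -> right_ambit actY y0 ->
  (forall (V : set G) (A : set G), nbhs 1%g V ->
    exists C : set X, [/\ clopen C, forall g, A g -> C (actX x0 g)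
      & forall g, C (actX x0 g) -> exists a v, [/\ A a, V v & g = (a * v)%g]]) ->
  forall x, exists y : Y, forall W, nbhs y W ->
    exists D, [/\ open D, D x & forall g, D (actX x0 g) -> W (actY y0 g)].
Proof.
move=> [_ _ _ _ dX] [coY hY [Y1 YM] cY _] sep x.
pose F := filter_from [set D : set X | open D /\ D x]
  (fun D => [set actY y0 g | g in [set g | D (actX x0 g)]]).
have FF : ProperFilter F.
  apply: filter_from_proper => [|D [oD Dx]].
    apply: filter_from_filter; first by exists setT; split => //; exact: openT.
    move=> D1 D2 [o1 D1x] [o2 D2x]; exists (D1 `&` D2).
      by split; [exact: openI|split].
    by move=> _ [g [D1g D2g] <-]; split; exists g.
  have [|z [Dz [g _ gE]]] := dX D _ oD; first by exists x.
  by exists (actY y0 g), g => //; rewrite /= gE.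
have [y [_ Fy]] := coY F FF filterT.
exists y => W yW.
have : nbhs (actY y 1%g) W by rewrite Y1.
(* Continuity of the action at [(y, 1)] gives [B V] inside [W], and [C] meets the orbit only in
   points [x0 (a v)] with [y0 a] in [B] and [v] in [V]. *)
move=> /(cY (y, 1%g))[[B V] /= [yB V1] BVW].
have [C [[oC cC] AC CA]] := sep V [set g | B (actY y0 g)] V1.
exists C; split => //; last first.
  move=> g /CA[a [v [Ba Vv ->]]]; rewrite YM.
  exact: (BVW (actY y0 a, v)).
apply: contrapT => nCx.
have FC : F [set actY y0 g | g in [set g | (~` C) (actX x0 g)]].
  by exists (~` C) => //; split => //; exact: closed_openC.
have [_ [[g nCg <-] Bg]] := Fy _ _ FC yB.
exact/nCg/AC.
Qed.

(* The hypothesis on clopen sets says that the uniformly continuous functions on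
   G extend to X; it makes y0 * g converge as x0 * g tends to a point of X. *)
Lemma separating_ambit_universal (X : topologicalType) (actX : X -> G -> X)
    (x0 : X) :
  right_ambit actX x0 ->
  (forall (V : set G) (A : set G), nbhs 1%g V ->
    exists C : set X, [/\ clopen C, forall g, A g -> C (actX x0 g)
      & forall g, C (actX x0 g) -> exists a v, [/\ A a, V v & g = (a * v)%g]]) ->
  universal_right_ambit actX x0.
Proof.
move=> aX sep; split => // Y actY y0 aY.
have /choice[f fP] := ambit_limit aX aY sep.
have [coX hX [X1 XM] cX dX] := aX; have [coY hY [Y1 YM] cY dY] := aY.
have cf : continuous f.
  move=> x W fW.
  (* For [z] near [x], [f z] is only known to be a limit of points [y0 g] in [W'], so the closure of
     [W'] must lie in [W]. *)
  have [W' W'f W'W] :=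
    compact_regular hY coY (@filterT _ (nbhs (f x)) _) fW.
  have [D [oD Dx DW]] := fP x _ W'f.
  have : nbhs x D by exact: open_nbhs_nbhs.
  apply: filterS => z Dz; apply: W'W => B /(fP z)[D' [oD' D'z DB]].
  have [|u [[Du D'u] [g _ gE]]] := dX (D `&` D') _ (openI oD oD').
    by exists z.
  by exists (actY y0 g); split; [apply: DW | apply: DB]; rewrite gE.
have fo g : f (actX x0 g) = actY y0 g.
  apply: hY => A B /(fP _)[D [oD Dg DA]] Bg; exists (actY y0 g); split.
    exact: DA.
  exact: nbhs_singleton Bg.
exists f; split => //.
- move=> x g; apply: (congr1 (@^~ x)
    (hausdorff_dense_eq hY (f := f \o actX^~ g) (h := actY^~ g \o f) _ _ dX _)).
  + move=> z; apply: continuous_comp; last exact: cf.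
    exact: right_ambit_act_continuous aX z.
  + move=> z; apply: continuous_comp; first exact: cf.
    exact: right_ambit_act_continuous aY (f z).
  + by move=> _ [h _ <-] /=; rewrite -XM !fo YM.
- by rewrite -(X1 x0) fo Y1.
(* The image is compact, hence closed, and it contains the dense orbit of [y0]. *)
- have cl : closed (range f).
    apply: compact_closed => //; apply: continuous_compact => //.
    exact: continuous_subspaceT.
  apply/seteqP; split => // y _; apply: contrapT => ny.
  have [|z [nz [g _ gE]]] := dY (~` range f) _ (closed_openC cl).
    by exists y.
  by apply: nz; exists (actX x0 g) => //; rewrite fo.
Qed.

(** Universality gives maps [f] and [h] in both directions, and [f \o h] is the identity because it
    fixes a dense orbit. Clopen sets of [X] therefore pull back along [h] to a base of [Y]. *)
Lemma universal_ambit_clopen_base (X Y : topologicalType) (actX : X -> G -> X)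
    (x0 : X) (actY : Y -> G -> Y) (y0 : Y) :
  universal_right_ambit actX x0 -> universal_right_ambit actY y0 ->
  clopen_base X -> clopen_base Y.
Proof.
move=> [aX uX] [aY uY] [_ bX].
have [f [cf ef f0 _]] := uX _ _ _ aY; have [h [ch eh h0 _]] := uY _ _ _ aX.
have hY : hausdorff_space Y by case: aY.
have fhE y : f (h y) = y.
  have : f \o h = id.
    apply: (@right_ambit_map_unique _ _ actY y0 actY y0) => //=.
    - by move=> z; apply: continuous_comp; [exact: ch | exact: cf].
    - by move=> z; exact: cvg_id.
    - by move=> z g; rewrite eh ef.
    - by rewrite h0 f0.
  by move/(congr1 (@^~ y)).
split=> [U []//|y W yW].
have : nbhs (h y) (f @^-1` W) by apply: cf; rewrite fhE.
move=> /bX[U [cU Uhy] UW]; exists (h @^-1` U).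
  by split => //; exact: preimage_clopen.
by move=> z /UW; rewrite /= fhE.
Qed.

End AmbitTheory.

(** * Finite support of formulas and elementary facts on complete types *)

Section FirstOrderTheory.
Variables (S : Type) (Sg : signature S).

Lemma env_eq (V A : S -> Type) (v w : forall s, V s -> A s) :
  (forall s x, v s x = w s x) -> v = w.
Proof.
by move=> vw; apply: functional_extensionality_dep => s; exact/funext/vw.
Qed.

Lemma hmap_comp (A B C : S -> Type) (f : forall s, A s -> B s)
    (h : forall s, B s -> C s) (l : seq S) (x : hprod A l) :
  hmap h (hmap f x) = hmap (fun s a => h s (f s a)) x.
Proof. by elim: l x => //= s l IH x; rewrite IH. Qed.

Lemma hmap_finsupp (V : S -> Type) (l : seq S) (x : hprod V l) :
  exists2 F : set {s : S & V s}, finite_set F &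
    forall (A : S -> Type) (v w : forall s, V s -> A s),
      (forall s y, F (existT _ s y) -> v s y = w s y) -> hmap v x = hmap w x.
Proof.
elim: l x => [|s l IH] /= x; first by exists set0.
have [F fF FP] := IH x.2; exists (F `|` [set existT _ s x.1]).
  by rewrite finite_setU; split => //; exact: finite_set1.
move=> A v w vw; rewrite (vw _ x.1); last by right.
by rewrite (FP A v w)// => t y Fy; apply: vw; left.
Qed.

Definition old_var (V : S -> Type) (s : S) (z : {t : S & extend V s t}) :
    option {t : S & V t} :=
  match projT2 z with
  | Old t y => Some (existT _ t y)
  | New => None
  end.

Lemma sat_finsupp (V : S -> Type) (phi : form Sg V) :
  exists2 F : set {s : S & V s}, finite_set F &
    forall (N : model Sg) (v w : forall s, V s -> N s),
      (forall s y, F (existT _ s y) -> v s y = w s y) ->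
      sat phi v <-> sat phi w.
Proof.
elim: phi => {V} [V R x|V s x y|V|V p [F fF FP]|V p [F fF FP] q [E fE EP]
  |V s p [F fF FP]].
- have [F fF FP] := hmap_finsupp x; exists F => // N v w vw /=.
  by rewrite (FP N v w vw).
- exists [set existT _ s x; existT _ s y].
    by rewrite finite_setU; split; exact: finite_set1.
  by move=> N v w vw /=; rewrite !(vw s)//; [right|left].
- by exists set0.
- by exists F => // N v w vw /=; have := FP N v w vw; tauto.
- exists (F `|` E); first by rewrite finite_setU.
  move=> N v w vw /=.
  have : sat p v <-> sat p w by apply: FP => t z Fz; apply: vw; left.
  have : sat q v <-> sat q w by apply: EP => t z Ez; apply: vw; right.
  tauto.
(* The support of the body with the bound variable, sent to [None], removed. *)
- exists (Some @^-1` ((@old_var V s) @` F)).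
    by apply: finite_preimage; [move=> ? ? _ _ [] | exact: finite_image].
  move=> N v w vw /=; have FPa (a : N s) :
      sat p (extend_env v a) <-> sat p (extend_env w a).
    apply: FP => t [t' z|] //= Fz; apply: vw.
    by exists (existT _ t' (Old z)).
  by split=> -[a pa]; exists a; exact/FPa.
Qed.

Lemma ct_not (N : model Sg) (V : S -> Type) (p : complete_type N V)
  (phi : form Sg V) : p (Not phi) <-> ~ p phi.
Proof.
split=> [pn pp|]; last by have [] := ct_complete p phi.
have [| |v vq] := @ct_finsat _ _ _ _ p [set Not phi; phi].
- by rewrite finite_setU; split; exact: finite_set1.
- by move=> x [->|->].
- by have := vq (Not phi); apply => //; [left | apply: vq; right].
Qed.

Lemma ct_eq (N : model Sg) (V : S -> Type) (p q : complete_type N V) :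
  (forall phi, p phi <-> q phi) -> p = q.
Proof.
move=> pq; have : ct_set p = ct_set q by apply/funext => phi; exact/propext.
case: p q {pq} => [p p1 p2] [q q1 q2] /= pq.
by move: p1 p2; rewrite pq => *; congr CompleteType; exact: Prop_irrelevance.
Qed.

Lemma ct_open (N : model Sg) (V : S -> Type) (phi : form Sg V) :
  open [set p : complete_type N V | p phi].
Proof. by rewrite openE => p pphi; exists phi. Qed.

Lemma ct_clopen (N : model Sg) (V : S -> Type) (phi : form Sg V) :
  clopen [set p : complete_type N V | p phi].
Proof.
split; first exact: ct_open.
have -> : [set p : complete_type N V | p phi] =
          ~` [set p : complete_type N V | p (Not phi)].
  by apply/seteqP; split => p /=; rewrite ct_not; [tauto | exact: contrapT].
exact/open_closedC/ct_open.
Qed.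

End FirstOrderTheory.

(** * Substitution of terms built from the action *)

Section Substitution.
Variables (L : language) (M : structure L).
Implicit Types V W : full_sort -> Type.

(** Depth one suffices: only single variables and expressions such as sigma(m i) are ever
    substituted. *)
Inductive action_term W : full_sort -> Type :=
| TVar s of W s : action_term W s
| TApp of W sortG & W sortM : action_term W sortM.

Definition term_map W W' (i : forall s, W s -> W' s) s (t : action_term W s) :
    action_term W' s :=
  match t with
  | TVar s x => TVar (i s x)
  | TApp g a => TApp (i _ g) (i _ a)
  end.

(** In continuation-passing style, since eliminating [TApp] enlarges the context: [k] receives the
    new context, the inclusion of the old one, and a variable holding the value of the term. *)
Definition flatten1 W s (t : action_term W s) :
    (forall W', (forall s', W s' -> W' s') -> W' s -> form (full_sig M) W') ->
    form (full_sig M) W :=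
  match t with
  | TVar s x => fun k => k W (fun _ => id) x
  | TApp g a => fun k => Ex sortM
      (And (Rel (action_sym M) (Old g, (Old a, (New, tt))))
        (k (extend W sortM) (fun _ => Old) New))
  end.

Fixpoint flatten_args (l : seq full_sort) {struct l} :
    forall W, hprod (action_term W) l ->
    (forall W', (forall s, W s -> W' s) -> hprod W' l ->
      form (full_sig M) W') -> form (full_sig M) W :=
  match l with
  | [::] => fun W _ k => k W (fun _ => id) tt
  | s :: l' => fun W x k => flatten1 x.1 (fun W1 i1 y =>
      flatten_args (hmap (term_map i1) x.2) (fun W2 i2 ys =>
        k W2 (fun s' z => i2 s' (i1 s' z)) (i2 _ y, ys)))
  end.

Definition term_lift V W s (T : forall t, V t -> action_term W t) t
    (x : extend V s t) : action_term (extend W s) t :=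
  match x with
  | Old t y => term_map (fun _ => Old) (T t y)
  | New => TVar New
  end.

(* Function symbols are absent from the language, so that a term g(a) is
   eliminated as a bound variable constrained by the graph of the action. *)
Fixpoint subst V (phi : form (full_sig M) V) :
    forall W, (forall s, V s -> action_term W s) -> form (full_sig M) W :=
  match phi with
  | Rel R x => fun W T => flatten_args (hmap T x) (fun _ _ => Rel R)
  | Equ s x y => fun W T => flatten1 (T s x) (fun W1 i x' =>
      flatten1 (term_map i (T s y)) (fun W2 j y' => Equ (j s x') y'))
  | Bot => fun _ _ => Bot
  | Not p => fun _ T => Not (subst p T)
  | And p q => fun _ T => And (subst p T) (subst q T)
  | Ex s p => fun _ T => Ex s (subst p (term_lift T))
  end.

Variable N : elementary_extension (full_model M).

Lemma star_actP (sigma : N sortG) a : action_graph sigma a (star_act sigma a).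
Proof. by rewrite /star_act; case: cid. Qed.

Lemma star_act_eq (sigma : N sortG) a b :
  action_graph sigma a b -> star_act sigma a = b.
Proof. by move=> ab; apply: action_graph_functional ab; exact: star_actP. Qed.

Definition term_val W (w : forall s, W s -> N s) s (t : action_term W s) : N s :=
  match t with
  | TVar s x => w s x
  | TApp g a => star_act (w _ g) (w _ a)
  end.

Lemma term_val_map W W' (i : forall s, W s -> W' s) (w : forall s, W' s -> N s)
    s (t : action_term W s) :
  term_val w (term_map i t) = term_val (fun s x => w s (i s x)) t.
Proof. by case: t. Qed.

(** The graph of the action is total and functional, so the bound variable has exactly one
    admissible value, that of the term. *)
Lemma sat_flatten1 W s (t : action_term W s) k (w : forall s, W s -> N s)
    (P : N s -> Prop) :
  (forall W' (i : forall s', W s' -> W' s') y (w' : forall s', W' s' -> N s'),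
     (fun s' x => w' s' (i s' x)) = w ->
     sat (k W' i y) w' <-> P (w' s y)) ->
  sat (flatten1 t k) w <-> P (term_val w t).
Proof.
case: t k P => [s' x|g a] k P kP /=; first exact: kP.
split=> [[b [/star_act_eq -> /kP]]|Pa]; first exact.
by exists (star_act (w _ g) (w _ a)); split; [exact: star_actP | apply/kP].
Qed.

Lemma sat_flatten_args (l : seq full_sort) W (x : hprod (action_term W) l) k
    (w : forall s, W s -> N s) (P : hprod N l -> Prop) :
  (forall W' (i : forall s', W s' -> W' s') y (w' : forall s', W' s' -> N s'),
     (fun s' x => w' s' (i s' x)) = w ->
     sat (k W' i y) w' <-> P (hmap w' y)) ->
  sat (flatten_args x k) w <-> P (hmap (term_val w) x).
Proof.
elim: l W x k w P => [|s l IH] W x k w P kP /=; first exact: kP.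
apply: (@sat_flatten1 _ _ _ _ _
  (fun a => P (a, hmap (term_val w) x.2))) => W1 i1 y w1 w1E.
have -> : @term_val W w = fun s t => term_val w1 (term_map i1 t).
  by apply: env_eq => s' t; rewrite term_val_map w1E.
rewrite -(hmap_comp (term_map i1) (@term_val W1 w1)).
apply: (IH _ _ _ _ (fun ys => P (w1 s y, ys))) => W2 i2 ys w2 w2E.
rewrite -w2E; apply: (kP _ _ (i2 s y, ys)).
by rewrite -w1E -w2E.
Qed.

Lemma sat_subst V (phi : form (full_sig M) V) W
    (T : forall s, V s -> action_term W s) (w : forall s, W s -> N s) :
  sat (subst phi T) w <-> sat phi (fun s x => term_val w (T s x)).
Proof.
elim: phi W T w => {V} [V R x|V s x y|V|V p IH|V p IHp q IHq|V s p IH] W T w /=.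
- rewrite -(hmap_comp T (term_val w)).
  by apply: sat_flatten_args => W' i y w' _.
- apply: (@sat_flatten1 _ _ _ _ _ (fun a => a = term_val w (T s y))).
  move=> W1 i x' w1 <-; rewrite -term_val_map.
  by apply: (@sat_flatten1 _ _ _ _ _ (fun a => w1 s x' = a)) => W2 j y' w2 <-.
- by [].
- by have := IH W T w; tauto.
- by have := IHp W T w; have := IHq W T w; tauto.
- have E (a : N s) : (fun t x => term_val (extend_env w a) (term_lift T x)) =
      extend_env (fun t x => term_val w (T t x)) a.
    by apply: env_eq => t [t' x|] //=; rewrite term_val_map.
  by split=> -[a]; [move/IH; rewrite E | rewrite -E => /IH]; exists a.
Qed.

End Substitution.

Fixpoint list_args (J : Type) (B : full_sort -> Type) (f : J -> B sortM)
    (l : seq J) : hprod B [seq sortM | _ <- l] :=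
  if l is j :: l' then (f j, list_args f l') else tt.

Lemma hmap_list_args (J : Type) (A B : full_sort -> Type)
    (h : forall s, A s -> B s) (f : J -> A sortM) (l : seq J) :
  hmap h (list_args f l) = list_args (fun j => h sortM (f j)) l.
Proof. by elim: l => //= j l ->. Qed.

Lemma list_args_inj (J : eqType) (B : full_sort -> Type) (f h : J -> B sortM)
    (l : seq J) : list_args f l = list_args h l -> {in l, f =1 h}.
Proof.
elim: l => //= j l IH [fh /IH lfh] k; rewrite inE => /predU1P[->//|].
exact: lfh.
Qed.

(** * The type space [Sigma] and the action of Aut(M) on it *)

Section TypeSpace.
Variables (L : language) (M : structure L) (I : Type) (m : I -> M).
Hypothesis m_enum : forall a : M, exists i : I, m i = a.
Variable N : elementary_extension (full_model M).

Local Notation X := (set_type (Sigma N m)).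
Local Notation star := (star_incl N).
Local Notation starG := (@ee_emb _ _ _ N sortG).

Definition tuple_fun (B : full_sort -> Type) (f : I -> B sortM) (s : full_sort) :
    tuple_vars I s -> B s :=
  match s with sortG => fun x => of_void _ x | sortM => f end.

Lemma tuple_fun_comp (A : full_sort -> Type) (f : I -> A sortM)
    (h : forall s, A s -> N s) :
  (fun s x => h s (tuple_fun f x)) = tuple_env (fun i => h sortM (f i)).
Proof. by apply: env_eq => -[[]|]. Qed.

Lemma star_act_emb (g : aut M) (a : M) :
  star_act (starG g) (star a) = star (g a).
Proof.
apply: star_act_eq.
(* Every element of the small model serves as a variable naming itself. *)
pose v s (x : full_carrier M s) : full_model M s := x.
have [+ _] := ee_elementary N
  (Rel (V := full_carrier M) (action_sym M) (g, (a, (g a, tt)))) v.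
by apply.
Qed.

(** Transfer of closure under composition: the sentence [phi] holds in the small model, with [g * h]
    as witness. *)
Lemma star_act_comp (sigma tau : N sortG) :
  exists rho : N sortG, forall a,
    star_act rho a = star_act sigma (star_act tau a).
Proof.
pose V (s : full_sort) : Type := void.
pose phi : form (full_sig M) V := Not (Ex sortG (Ex sortG (Not (Ex sortG (Not
  (Ex sortM (Ex sortM (Ex sortM
    (And (And
      (Rel (action_sym M)
        (Old (Old (Old (Old New))), (Old (Old New), (Old New, tt))))
      (Rel (action_sym M)
        (Old (Old (Old (Old (Old New)))), (Old New, (New, tt)))))
      (Not (Rel (action_sym M)
        (Old (Old (Old New)), (Old (Old New), (New, tt)))))))))))))).
have [+ _] := ee_elementary N phi (fun s (x : V s) => of_void _ x).
move=> H; apply: contrapT => nrho; apply: H.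
  move=> [g [h]]; apply; exists (g * h)%g => -[a [b [c [[/= <- <-]]]]].
  exact.
exists sigma, tau => -[rho rhoP]; apply: nrho; exists rho => a.
apply: star_act_eq; apply: contrapT => na; apply: rhoP.
exists a, (star_act tau a), (star_act sigma (star_act tau a)).
by split => //; split; exact: star_actP.
Qed.

Definition sigma_tp (sigma : N sortG) (g : aut M) :
    complete_type N (tuple_vars I) :=
  tp_full (fun i => star_act sigma (star (g (m i)))).

Lemma sigma_tp_mem (sigma : N sortG) (g : aut M) :
  sigma_tp sigma g \in Sigma N m.
Proof.
rewrite inE; have [rho rhoE] := star_act_comp sigma (starG g).
exists rho; congr tp_full; apply/funext => i.
by rewrite rhoE star_act_emb.
Qed.

(** As [m] enumerates M, each [g (m i)] is some [m (pi i)], so acting by [g] renames variables. The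
    renaming depends on [g] alone, which makes the action independent of the representative
    [sigma]. *)
Lemma sigma_tp_reindex (g : aut M) :
  exists T : forall s, tuple_vars I s -> action_term (tuple_vars I) s,
  forall (sigma : N sortG) (h : aut M) phi,
    sigma_tp sigma (h * g)%g phi <-> sigma_tp sigma h (subst phi T).
Proof.
have /choice[pi piE] : forall i, exists j, m j = g (m i).
  by move=> i; exact: m_enum.
exists (tuple_fun (fun i => TVar (W := tuple_vars I) (s := sortM) (pi i))).
move=> sigma h phi; rewrite /sigma_tp /tp_full /= sat_subst tuple_fun_comp /=.
suff -> : (fun i => star_act sigma (star (h (m (pi i))))) =
  (fun i => star_act sigma (star ((h * g)%g (m i)))) by [].
by apply/funext => i; rewrite piE.
Qed.

Lemma sigma_tpM (sigma tau : N sortG) (h k g : aut M) :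
  sigma_tp sigma h = sigma_tp tau k ->
  sigma_tp sigma (h * g)%g = sigma_tp tau (k * g)%g.
Proof.
move=> E; have [T TP] := sigma_tp_reindex g.
by apply: ct_eq => phi; rewrite !TP E.
Qed.

Lemma SigmaP (p : X) : exists sigma, set_val p = sigma_tp sigma 1%g.
Proof. by case: p => p pS; rewrite set_valE /=; move: pS; rewrite inE. Qed.

Definition sigma_pt (sigma : N sortG) (g : aut M) : X :=
  exist _ (sigma_tp sigma g) (sigma_tp_mem sigma g).

Lemma set_val_sigma_pt sigma g : set_val (sigma_pt sigma g) = sigma_tp sigma g.
Proof. by rewrite set_valE. Qed.

Lemma sigma_ptE (p : X) sigma g :
  set_val p = sigma_tp sigma g -> p = sigma_pt sigma g.
Proof. by move=> E; apply: val_inj; rewrite /= -E set_valE. Qed.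

(** The representative is chosen; [sigma_actE] shows that any other gives the same result. *)
Definition sigma_act (p : X) (g : aut M) : X :=
  sigma_pt (sval (cid (SigmaP p))) g.

Lemma sigma_actE (p : X) sigma h g : set_val p = sigma_tp sigma h ->
  set_val (sigma_act p g) = sigma_tp sigma (h * g)%g.
Proof.
rewrite /sigma_act set_val_sigma_pt; case: cid => tau /= -> E.
by rewrite -(sigma_tpM g E) mul1g.
Qed.

Definition sigma_base : X := sigma_pt (starG 1%g) 1%g.

Lemma sigma_orbitE (g : aut M) :
  set_val (sigma_act sigma_base g) = tp_full (fun i => star (g (m i))).
Proof.
rewrite (@sigma_actE _ (starG 1%g) 1%g) ?set_val_sigma_pt// mul1g.
by congr tp_full; apply/funext => i; rewrite star_act_emb.
Qed.

Lemma sigma_orbitP (g : aut M) phi :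
  set_val (sigma_act sigma_base g) phi <->
  sat (N := full_model M) phi
    (tuple_fun (B := full_model M) (fun i => g (m i))).
Proof.
apply: iff_trans (iff_sym (ee_elementary N phi _)).
by rewrite sigma_orbitE (tuple_fun_comp _ (@ee_emb _ _ _ N)).
Qed.

(** * The topology of [Sigma]: clopen base, separation, compactness *)

Lemma sigma_clopen phi : clopen [set p : X | set_val p phi].
Proof.
apply: (preimage_clopen (ct_clopen (Sg := full_sig M) N phi)).
exact: initial_continuous.
Qed.

Lemma sigma_nbhs (p : X) (W : set X) : nbhs p W ->
  exists2 phi, set_val p phi & [set q : X | set_val q phi] `<=` W.
Proof.
rewrite nbhsE => -[_ [[O oO <-] Op] OW].
have [phi pphi phiO] : nbhs (set_val p) O by exact: open_nbhs_nbhs.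
by exists phi => // q /phiO; exact: OW.
Qed.

Lemma sigma_clopen_base : clopen_base X.
Proof.
split=> [U []//|p W /sigma_nbhs[phi pphi phiW]].
exists [set q : X | set_val q phi] => //; split => //; exact: sigma_clopen.
Qed.

Lemma sigma_hausdorff : hausdorff_space X.
Proof.
move=> p q pq; apply: val_inj; apply: ct_eq => phi.
suff H : forall psi, set_val p psi -> set_val q psi.
  split; rewrite -!set_valE; first exact: H.
  by move=> qphi; apply: contrapT => /ct_not/H/ct_not.
move=> psi ppsi; apply: contrapT => /ct_not qpsi.
have [] := pq [set x : X | set_val x psi] [set x : X | set_val x (Not psi)].
- by apply: open_nbhs_nbhs; split => //; have [] := sigma_clopen psi.
- by apply: open_nbhs_nbhs; split => //; have [] := sigma_clopen (Not psi).
- by move=> x [/= xp /ct_not].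
Qed.

(* An ultrafilter on Sigma gives a finitely satisfiable set of formulas in the one
   variable sigma over the parameters M, to which saturation applies. *)
Lemma sigma_compact (K : Type) : monster K N -> compact [set: X].
Proof.
move=> [_ [cK nK] Nsat _]; rewrite compact_ultra => F FU _.
pose emb (z : {s : full_sort & full_carrier M s}) : {s : full_sort & N s} :=
  existT _ (projT1 z) (ee_emb N (projT2 z)).
pose B := emb @` setT.
have cB : card_below K B.
  have lB : (B #<= [set: {s : full_sort & full_carrier M s}])%card.
    exact: card_image_le.
  by split; [exact: card_le_trans lB cK | move=> /card_le_trans/(_ lB)].
have Bm (i : I) : B (existT _ sortM (star (m i))).
  by exists (existT _ sortM (m i)).
pose W := extend (params (N := N) B) sortG.
pose c i : params (N := N) B sortM :=
  exist (fun x => B (existT _ sortM x)) (star (m i)) (Bm i).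
pose T := tuple_fun (fun i => TApp (W := W) New (Old (c i))).
pose w (sigma : N sortG) : forall s, W s -> N s :=
  extend_env (params_val (B := B)) sigma.
have satT sigma phi : sat (subst phi T) (w sigma) <-> sigma_tp sigma 1%g phi.
  by rewrite sat_subst tuple_fun_comp.
have [|sigma sigmaP] := Nsat B cB sortG
    [set psi | exists2 phi, F [set p : X | set_val p phi] & psi = subst phi T].
  move=> q /finite_fsetP[D ->] qF.
  (* [C psi] collects the points all of whose representatives satisfy [psi]. Finitely many such sets
     belonging to [F] have a common point, whose representative is the witness sought. *)
  pose C psi : set X := [set p : X | forall sigma,
    set_val p = sigma_tp sigma 1%g -> sat psi (w sigma)].
  have Cphi phi psi : psi = subst phi T -> [set p : X | set_val p phi] `<=` C psi.
    by move=> -> p pphi sigma pE; apply/satT; rewrite -pE.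
  have [|p pC] := filter_ex (@filter_bigI _ _ D C F _ _).
    by move=> psi /qF[phi Fphi psiE]; exact: filterS (Cphi _ _ psiE) Fphi.
  have [sigma pE] := SigmaP p.
  by exists sigma => psi Dpsi; exact: pC.
exists (sigma_pt sigma 1%g); split => // A /sigma_nbhs[phi].
rewrite set_val_sigma_pt => sphi phiA; apply: filterS phiA _.
(* Otherwise the ultrafilter contains the complement, and [sigma] would realise [Not phi] as
   well. *)
have [//|Fn] := in_ultra_setVsetC [set p : X | set_val p phi] FU.
exfalso; have /sigmaP/satT/ct_not : exists2 phi',
    F [set p : X | set_val p phi'] & subst (Not phi) T = subst phi' T.
  by exists (Not phi) => //; apply: filterS Fn => p /= /ct_not.
exact.
Qed.

(** * The ambit axioms and universality *)

Lemma sigma_right_action : right_action sigma_act.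
Proof.
split=> [p|p g h]; have [sigma pE] := SigmaP p.
  rewrite [RHS](sigma_ptE pE); apply: sigma_ptE.
  by rewrite (sigma_actE _ pE) mulg1.
rewrite [LHS](sigma_ptE (sigma_actE _ pE)); symmetry; apply: sigma_ptE.
by rewrite (sigma_actE _ (sigma_actE _ pE)) mulgA.
Qed.

Lemma sigma_act_continuous :
  continuous (fun z : X * aut M => sigma_act z.1 z.2).
Proof.
move=> [p g] A /sigma_nbhs[phi /= pphi phiA].
have [F fF FP] := sat_finsupp phi.
pose u (z : {s : full_sort & tuple_vars I s}) : M :=
  match z with
  | existT sortG x => of_void _ x
  | existT sortM i => m i
  end.
have [T TP] := sigma_tp_reindex g.
have actT q : set_val (sigma_act q g) phi <-> set_val q (subst phi T).
  have [sigma qE] := SigmaP q.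
  by rewrite (sigma_actE _ qE) TP qE.
(* The first factor controls the point with [g] fixed; the second makes [h] agree with [g] on the
   finitely many entries of [m] that [phi] sees. *)
exists ([set q : X | set_val q (subst phi T)], agree_on g (u @` F)) => /=.
  split; last by exists (u @` F) => //; exact: finite_image.
  apply: open_nbhs_nbhs; split; first by have [] := sigma_clopen (subst phi T).
  exact/actT.
move=> [q h] /= [/actT qphi gh].
suff : set_val (sigma_act q h) phi by exact: phiA.
have [sigma qE] := SigmaP q.
move: qphi; rewrite (sigma_actE g qE) (sigma_actE h qE) !mul1g.
have [[[]|i Fi] //=|+ _] := FP N
  (tuple_env (fun i => star_act sigma (star (g (m i)))))
  (tuple_env (fun i => star_act sigma (star (h (m i))))); last by apply.
by rewrite gh//; exists (existT _ sortM i).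
Qed.

(** A basic open set containing the type of sigma(m) says that a formula over M has a solution in
    the sort of [sigma]; elementarity provides a solution in Aut(M). *)
Lemma sigma_orbit_dense : dense (range (sigma_act sigma_base)).
Proof.
move=> O [p Op] oO.
have [phi pphi phiO] : exists2 phi, set_val p phi &
    [set q : X | set_val q phi] `<=` O.
  by apply: sigma_nbhs; exact: open_nbhs_nbhs.
suff [g gphi] : exists g, set_val (sigma_act sigma_base g) phi.
  by exists (sigma_act sigma_base g); split; [exact: phiO | exists g].
pose W := extend (full_carrier M) sortG.
pose T := tuple_fun (fun i => TApp (W := W) New (Old (m i : full_carrier M sortM))).
pose v s (x : full_carrier M s) : full_model M s := x.
have [sigma pE] := SigmaP p.
have [_ [|g gphi]] := ee_elementary N (Ex sortG (subst phi T)) v.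
  by exists sigma; apply/sat_subst; rewrite tuple_fun_comp; rewrite pE in pphi.
exists g; have [+ _] := ee_elementary N (subst phi T) (extend_env v g).
move=> /(_ gphi)/sat_subst; rewrite tuple_fun_comp sigma_orbitE /=.
suff -> : (fun i => star_act (starG g) (star (m i))) = (fun i => star (g (m i))).
  by [].
by apply/funext => i; exact: star_act_emb.
Qed.

Lemma sigma_right_ambit (K : Type) :
  monster K N -> right_ambit sigma_act sigma_base.
Proof.
move=> NK; split.
- exact: sigma_compact NK.
- exact: sigma_hausdorff.
- exact: sigma_right_action.
- exact: sigma_act_continuous.
- exact: sigma_orbit_dense.
Qed.

(* For F finite, a union of cosets of Stab(F) is cut out on the orbit of the base
   point by the predicate listing the images of F, which is in the full language. *)
Lemma sigma_separation (V A : set (aut M)) : nbhs 1%g V ->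
  exists C : set X, [/\ clopen C, forall g, A g -> C (sigma_act sigma_base g)
    & forall g, C (sigma_act sigma_base g) ->
        exists a v, [/\ A a, V v & g = (a * v)%g]].
Proof.
move=> [F fF FV].
have [l Fl] : exists l : seq {classic M}, F = [set` l] by exact/finite_seqP.
have /choice[k kE] := m_enum.
pose R : sym (full_sig M) := existT (fun l => set (hprod (full_carrier M) l))
  [seq sortM | _ <- l]
  [set t | exists2 a, A a &
     t = list_args (B := full_carrier M) (a : {classic M} -> M) l].
pose phi : form (full_sig M) (tuple_vars I) :=
  Rel R (list_args (B := tuple_vars I) (k : {classic M} -> I) l).
have phiP g : set_val (sigma_act sigma_base g) phi <-> exists2 a, A a &
    list_args (B := full_carrier M) (g : {classic M} -> M) l =
    list_args (B := full_carrier M) (a : {classic M} -> M) l.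
  rewrite sigma_orbitP /= hmap_list_args.
  suff -> : (fun j => g (m (k j))) = g by [].
  by apply/funext => j; rewrite kE.
exists [set p : X | set_val p phi]; split.
- exact: sigma_clopen.
- by move=> g Ag; apply/phiP; exists g.
(* Since [a] and [g] agree on [F], the quotient fixes [F] pointwise and lies in [V]. *)
- move=> g /phiP[a Aa ga]; exists a, (a^-1 * g)%g; split => //.
    apply: FV => b; rewrite Fl => bl.
    change (aut_inv_fun a (g b) = b).
    by rewrite (list_args_inj ga bl) aut_Kinv.
  by rewrite mulgA mulgV mul1g.
Qed.

Lemma sigma_universal (K : Type) :
  monster K N -> universal_right_ambit sigma_act sigma_base.
Proof.
move=> NK; apply: separating_ambit_universal.
  exact: sigma_right_ambit NK.
by move=> V A V1; exact: sigma_separation.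
Qed.

End TypeSpace.

Theorem theorem3p2 (L : language) (M : structure L)
    (I : Type) (m : I -> M) (m_enum : forall a : M, exists i : I, m i = a)
    (K : Type) (N : elementary_extension (full_model M))
    (N_monster : monster K N) :
  (exists (act : Sigma N m -> aut M -> Sigma N m) (p0 : Sigma N m),
    [/\ (forall (p : Sigma N m) (sigma : N sortG) (g : aut M),
           set_val p = tp_full (fun i => star_act sigma (star_incl N (m i))) ->
           set_val (act p g) = tp_full (fun i => star_act sigma (star_incl N (g (m i))))),
        set_val p0 = tp_full (fun i => star_incl N (m i))
      & universal_right_ambit act p0]) /\
  (forall (X : topologicalType) (actX : X -> aut M -> X) (x0 : X),
     universal_right_ambit actX x0 -> clopen_base X).
Proof.
have univ := sigma_universal m_enum N_monster.
split=> [|X actX x0 uX]; last first.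
  exact: universal_ambit_clopen_base univ uX (@sigma_clopen_base _ _ _ _ _).
exists (sigma_act (m := m) (N := N)), (sigma_base m N); split => //.
  (* Holding for every representative [sigma] of [p], this is the well-definedness of the action. *)
  by move=> p sigma g pE; rewrite (sigma_actE m_enum (h := 1%g) g pE) mul1g.
rewrite set_val_sigma_pt; congr tp_full; apply/funext => i.
by rewrite star_act_emb.
Qed.
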